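(* Let $\Lambda\subset\Gamma\subset\Lambda'$ be Fitting orders over a Fitting domain $\mathfrak{o}$ in an algebra $A$, such that $\Lambda'$ is a maximal order, and let $M$ be a finitely generated $\Lambda$-module. If $\mathcal{H}(\Gamma) = \zeta(\Gamma)$, then $\mathcal{F}(\Gamma,\Lambda)\subset\mathcal{H}(\Lambda)$ and so $$\mathcal{F}(\Gamma,\Lambda)\cdot\mathrm{Fit}^{\max}_{\Lambda}(M)\subset\mathrm{Ann}_{\zeta(\Lambda)}(M).$$
   Context: Modules are left modules; $\zeta(\cdot)$ denotes the centre of a ring. A Fitting domain is an integrally closed complete commutative noetherian local domain $\mathfrak{o}$; let $F$ be its field of quotients. A Fitting order over $\mathfrak{o}$ is an $\mathfrak{o}$-order $\Lambda$ in a (finite dimensional) separable $F$-algebra $A$. Central conductor: $\mathcal{F}(\Gamma,\Lambda) := \{x\in\zeta(\Gamma)\mid x\Gamma\subset\Lambda\}$. Let $e_1,\dots,e_t$ be the central primitive idempotents of $A$, $A_i = Ae_i \simeq M_{n_i\times n_i}(D_i)$ with $D_i$ a skewfield, $F_i = \zeta(A_i)=\zeta(D_i)$, $[D_i:F_i]=s_i^2$. The reduced norm $\mathrm{nr}: M_{b\times b}(A)\to \zeta(A) = \bigoplus_i F_i$ is defined componentwise. Generalised adjoint: for $H\in M_{b\times b}(\Lambda)$ put $H_i = He_i$, $m_i = n_i s_i b$, let $f_i(X)=\sum_{j=0}^{m_i}\alpha_{ij}X^j$ be the reduced characteristic polynomial of $H_i$ (over $F_i$), and set $H_i^{\ast}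 := (-1)^{m_i+1}\sum_{j=1}^{m_i}\alpha_{ij}H_i^{j-1}$ (with $H_i^0$ the identity of $M_{b\times b}(A_i)$), $H^{\ast} := \sum_{i=1}^t H_i^{\ast}$; then $H^\ast H = HH^\ast = \mathrm{nr}(H)\cdot 1_{b\times b}$. For a Fitting order $\Lambda$ put $$\mathcal{H}(\Lambda) := \{x\in\zeta(\Lambda)\mid xH^{\ast}\in M_{b\times b}(\Lambda)\ \text{for all } H\in M_{b\times b}(\Lambda) \text{ and all } b\in\mathbb{N}\}.$$ Put $\mathcal{U}(\Lambda) := \langle \mathrm{nr}(H) \mid H \in \mathrm{GL}_b(\Lambda), b\in\mathbb{N}\rangle_{\zeta(\Lambda)} \subset \zeta(A)$. For a finite presentation $\Lambda^a \xrightarrow{h} \Lambda^b \twoheadrightarrow M$, identify $h$ with a matrix in $M_{a\times b}(\Lambda)$ (acting by right multiplication on row vectors), let $S_b(h)$ be the set of its $b\times b$ submatrices when $a\ge b$, and put $\mathrm{Fit}_\Lambda(h) := \langle \mathrm{nr}(H) \mid H\in S_b(h)\rangle_{\mathcal{U}(\Lambda)}$ if $a\ge b$ and $\mathrm{Fit}_\Lambda(h) := 0$ if $a<b$. Then $\mathrm{Fit}^{\max}_\Lambda(M)$ is the unique maximal element with respect to inclusion (which exists) among all $\mathrm{Fit}_\Lambda(h)$, $h$ running through the finite presentations of $M$. *)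

(* Defs.v *)
From HB Require Import structures.
From mathcomp Require Import all_boot all_order all_algebra all_field.
From mathcomp Require Import boolp classical_sets.

Set Implicit Arguments.
Unset Strict Implicit.
Unset Printing Implicit Defensive.

Import GRing.Theory.

Local Open Scope classical_set_scope.
Local Open Scope ring_scope.

Section FittingDomain.
Variable o : idomainType.
Implicit Types (I J : set o) (x : o) (u : nat -> o).

Definition ideal I : Prop :=
  [/\ I 0, forall x y, I x -> I y -> I (x + y) & forall c x, I x -> I (c * x)].

Definition ideal_gen (S : set o) : set o :=
  [set x | exists n (c g : 'I_n -> o),
     (forall i, S (g i)) /\ x = \sum_i c i * g i].

Definition noetherian : Prop :=
  forall I, ideal I -> exists s : seq o, I = ideal_gen [set` s].

Definition maximal_ideal I : Prop :=
  [/\ ideal I, ~ I 1 & forall J, ideal J -> I `<=` J -> J = I \/ J 1].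

Definition local_ring : Prop := exists! I, maximal_ideal I.

Definition ideal_pow I (k : nat) : set o :=
  ideal_gen [set x | exists y : 'I_k -> o, (forall i, I (y i)) /\ x = \prod_i y i].

(* Completeness includes separatedness. *)
Definition adically_complete I : Prop :=
  (forall x, (forall k, ideal_pow I k x) -> x = 0) /\
  (forall u,
     (forall k, exists N, forall i j, (N <= i)%N -> (N <= j)%N ->
        ideal_pow I k (u i - u j)) ->
     exists l, forall k, exists N, forall i, (N <= i)%N ->
        ideal_pow I k (u i - l)).

Definition integrally_closed : Prop :=
  forall z : {fraction o},
    integralOver (@tofrac o) z -> exists x, z = tofrac x.

Definition fitting_domain : Prop :=
  [/\ integrally_closed, noetherian, local_ring
    & forall I, maximal_ideal I -> adically_complete I].

End FittingDomain.

Section Centre.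
Variable A : nzRingType.

Definition centre (S : {pred A}) : set A :=
  [set x | x \in S /\ forall y, y \in S -> x * y = y * x].

Definition central_idempotent (e : A) : Prop :=
  centre predT e /\ e * e = e.

Definition central_primitive_idempotent (e : A) : Prop :=
  [/\ central_idempotent e, e != 0
    & forall f g, central_idempotent f -> central_idempotent g ->
        f * g = 0 -> e = f + g -> f = 0 \/ g = 0].

(* The centre F_i of the block A e, for e a central primitive idempotent. *)
Definition block_centre (e : A) : set A :=
  [set z | centre predT z /\ z * e = z].

Definition span_over (S G : set A) : set A :=
  [set x | exists n (c g : 'I_n -> A),
     [/\ forall i, S (c i), forall i, G (g i) & x = \sum_i c i * g i]].

End Centre.

Section SeparableAlgebra.
Variables (F : fieldType) (A : falgType F).

Definition left_ideal (U : {vspace A}) : Prop := ({:A} * U <= U)%VS.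

Definition semisimple_algebra : Prop :=
  forall U : {vspace A}, left_ideal U ->
    exists V : {vspace A},
      [/\ left_ideal V, (U + V)%VS = {:A}%VS & (U :&: V)%VS = 0%VS].

(* Semisimple, with the centre of every simple component separable over F:
   the irreducible p below is, up to a scalar, the minimal polynomial over F of
   z in the field block_centre e, whose unit is e. *)
Definition separable_algebra : Prop :=
  semisimple_algebra /\
  forall e z : A, central_primitive_idempotent e -> block_centre e z ->
    exists p : {poly F},
      [/\ irreducible_poly p, separable_poly p
        & (map_poly (in_alg A) p).[z] * e = 0].

End SeparableAlgebra.

Section ReducedNorm.
Variable A : nzRingType.

(* phi : A -> A e -> M_m(E) is a splitting of the central simple algebra A e
   over the field F_e := block_centre e: it makes E an extension of F_e and
   induces an isomorphism of E (x)_{F_e} A e with M_m(E), i.e. it sends an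
   F_e-basis u of A e to an E-basis. If A e = M_n(D) and [D : F_e] = s^2, then
   m^2 = [A e : F_e] = (n s)^2, so m = n s. *)
Definition splitting (e : A) (E : fieldType) (m : nat)
    (phi : {rmorphism A -> 'M[E]_m}) : Prop :=
  [/\ phi e = 1%:M,
      forall z, block_centre e z -> is_scalar_mx (phi z)
    & exists d (u : 'I_d -> A),
      [/\ forall k, u k * e = u k,
          forall a, a * e = a ->
            exists! z : 'rV[A]_d,
              (forall k, block_centre e (z 0 k)) /\ a = \sum_k z 0 k * u k
        & forall B : 'M[E]_m,
            exists! c : 'rV[E]_d, B = \sum_k c 0 k *: phi (u k)]].

(* f b H is the reduced characteristic polynomial of H e in M_b(A e): the
   polynomial over block_centre e that a splitting of A e maps to the
   characteristic polynomial of the (b m) x (b m) matrix phi(H). Its leading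
   coefficient is e, the unit of block_centre e. *)
Definition is_redcharpoly (e : A) (f : forall b, 'M[A]_b -> {poly A}) : Prop :=
  exists (E : fieldType) (m : nat) (phi : {rmorphism A -> 'M[E]_m}),
    splitting e phi /\
    forall b (H : 'M[A]_b) j,
      block_centre e (f b H)`_j /\
      phi (f b H)`_j
        = ((char_poly (\mxblock_(i < b, k < b) phi (H i k)))`_j)%:M.

(* For a central simple block, is_redcharpoly e has exactly one solution (it
   depends neither on E nor on phi); this picks it. *)
Definition redcharpoly (e : A) : forall b, 'M[A]_b -> {poly A} :=
  if pselect (exists f, is_redcharpoly e f) is left ex then sval (cid ex)
  else fun _ _ => 0.

(* n_i s_i b *)
Definition reddeg (e : A) b (H : 'M[A]_b) : nat := (size (redcharpoly e H)).-1.

Definition nr_block (e : A) b (H : 'M[A]_b) : A :=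
  (-1) ^+ reddeg e H * (redcharpoly e H)`_0.

(* e *: H ^+ k is the k-th power of H e in M_b(A e); for k = 0 this is the
   identity e of M_b(A e). *)
Definition adjoint_block (e : A) b (H : 'M[A]_b) : 'M[A]_b :=
  (-1) ^+ (reddeg e H).+1 *:
    \sum_(1 <= j < (reddeg e H).+1) (redcharpoly e H)`_j *: (e *: H ^+ j.-1).

Variables (t : nat) (e : 'I_t -> A).

Definition enumerates_central_primitive_idempotents : Prop :=
  injective e /\
  forall x, central_primitive_idempotent x <-> exists i, x = e i.

Definition nr b (H : 'M[A]_b) : A := \sum_i nr_block (e i) H.

Definition adjoint b (H : 'M[A]_b) : 'M[A]_b := \sum_i adjoint_block (e i) H.

Definition calH (L : {pred A}) : set A :=
  [set x | centre L x /\
     forall b (H : 'M[A]_b), H \is a mxOver L -> x *: adjoint H \is a mxOver L].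

Definition GL (L : {pred A}) b : set 'M[A]_b :=
  [set H | H \is a mxOver L /\
     exists K, [/\ K \is a mxOver L, H *m K = 1%:M & K *m H = 1%:M]].

Definition calU (L : {pred A}) : set A :=
  span_over (centre L) [set x | exists b (H : 'M[A]_b), GL L H /\ x = nr H].

Definition conductor (G L : {pred A}) : set A :=
  [set x | centre G x /\ forall y, y \in G -> x * y \in L].

End ReducedNorm.

Section OrderRing.
Variables (A : nzRingType) (L : subringClosed A).

Record order_ring := OrderRing { order_val :> A; _ : order_val \in L }.

HB.instance Definition _ := [isSub for order_val].
HB.instance Definition _ := [Choice of order_ring by <:].
HB.instance Definition _ := [SubChoice_isSubNzRing of order_ring by <:].

End OrderRing.

Section Orders.
Variables (o : idomainType) (A : falgType {fraction o}).

Definition is_order (L : subringClosed A) : Prop :=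
  (exists n (g : 'I_n -> A), forall x,
     x \in L <-> exists c : 'I_n -> o, x = \sum_i tofrac (c i) *: g i) /\
  (forall x, exists n (c : 'I_n -> {fraction o}) (g : 'I_n -> A),
     (forall i, g i \in L) /\ x = \sum_i c i *: g i).

Definition is_maximal_order (L : subringClosed A) : Prop :=
  is_order L /\
  forall L1 : subringClosed A, is_order L1 -> {subset L <= L1} -> L1 =i L.

End Orders.

Section FittingInvariant.
Variables (A : nzRingType) (t : nat) (e : 'I_t -> A).
Variables (L : subringClosed A) (M : lmodType (order_ring L)).

Definition fin_gen_module : Prop :=
  exists n (g : 'I_n -> M), forall x : M,
    exists c : 'I_n -> order_ring L, x = \sum_i c i *: g i.

Definition annihilator : set A :=
  [set x | exists z : order_ring L,
     [/\ x = val z, centre L x & forall y : M, z *: y = 0]].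

Definition is_presentation a b (h : 'M[order_ring L]_(a, b)) : Prop :=
  exists pi : {linear 'rV[order_ring L]_b -> M},
    (forall y, exists v, pi v = y) /\
    (forall v, pi v = 0 <-> exists w, v = w *m h).

(* The b x b submatrices of h are given by increasing selections of b rows. *)
Definition fit a b (h : 'M[order_ring L]_(a, b)) : set A :=
  if (b <= a)%N then
    span_over (calU e L)
      [set x | exists r : 'I_b -> 'I_a,
         {homo r : i j / (i < j)%N} /\ x = nr e (map_mx val (rowsub r h))]
  else [set 0].

Definition is_fit (I : set A) : Prop :=
  exists a b (h : 'M[order_ring L]_(a, b)), is_presentation h /\ I = fit h.

Definition is_fitmax (I : set A) : Prop :=
  is_fit I /\ forall J, is_fit J -> I `<=` J -> J = I.

(* The maximal element exists and is unique for finitely presented M over a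
   Fitting order L; this picks it. *)
Definition fitmax : set A :=
  if pselect (exists I, is_fitmax I) is left ex then sval (cid ex)
  else [set 0].

End FittingInvariant.

(* Main.v *)
(* A splitting phi of A e is injective on A e, so the Cayley-Hamilton theorem for
   the matrices phi(H) descends to the reduced characteristic polynomial and gives
   H^* H = nr(H).  As H(Gamma) contains 1, adjoints of matrices over Gamma are
   again over Gamma, hence so are their norms, and F(Gamma, Lambda), an ideal of
   the centre of Gamma, is stable under multiplication by U(Lambda).  For c in
   F(Gamma, Lambda) and H a maximal square submatrix of a presentation,
   the rows of c nr(H) = c H^* H then lie in the row space of the presentation, so
   c nr(H) kills the cokernel. *)
Require Import Defs.
From mathcomp Require Import all_boot all_order all_algebra all_field.
From mathcomp Require Import boolp classical_sets.

Set Implicit Arguments.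
Unset Strict Implicit.
Unset Printing Implicit Defensive.

Import GRing.Theory.

Local Open Scope classical_set_scope.
Local Open Scope ring_scope.

(** Coefficient form, ready to be pulled back along [phi]; size 0 is included because it occurs for
    b = 0. *)
Lemma Cayley_Hamilton_sum (R : comNzRingType) n (B : 'M[R]_n) :
  \sum_(j < n.+1) (char_poly B)`_j *: B ^+ j = 0.
Proof.
case: n B => [|n] B; first exact: flatmx0.
rewrite -[RHS](Cayley_Hamilton B).
rewrite -{2}(coefK (char_poly B)) size_char_poly poly_def raddf_sum /=.
by apply: eq_bigr => j _; rewrite linearZ /= rmorphXn /= horner_mx_X.
Qed.

Lemma centreT_in {A : nzRingType} (z : A) :
  centre predT z <-> forall y, z * y = y * z.
Proof. by split=> [[_ zC] y|zC]; [apply: zC | split]. Qed.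

(** * Blockwise images of matrices under a ring morphism *)

Section PhiBlock.
Context {A : nzRingType} {E : fieldType} {m : nat}.
Variable phi : {rmorphism A -> 'M[E]_m}.

Definition map_block b (H : 'M[A]_b) : 'M[E]_(\sum_(i < b) m) :=
  \mxblock_(i < b, k < b) phi (H i k).

Lemma map_block1 b : map_block (1%:M : 'M_b) = 1%:M.
Proof.
rewrite -(mxdiagZ 1); apply/eq_mxblockP => i k; rewrite mxE.
by case: (i == k); rewrite ?raddf0 // rmorph1 conform_mx_id.
Qed.

Lemma map_blockM b (H K : 'M[A]_b) :
  map_block (H *m K) = map_block H *m map_block K.
Proof.
rewrite mul_mxblock; apply/eq_mxblockP => i k.
by rewrite mxE rmorph_sum; apply: eq_bigr => j _; rewrite rmorphM.
Qed.

Lemma map_blockX b (H : 'M[A]_b) n : map_block (H ^+ n) = map_block H ^+ n.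
Proof.
elim: n => [|n IHn]; first exact: map_block1.
by rewrite !exprS map_blockM IHn.
Qed.

End PhiBlock.

(** * Injectivity of a splitting and descent of Cayley-Hamilton *)

Section Splitting.
Context {F : fieldType} {A : falgType F}.
Hypothesis A_separable : separable_algebra A.
Context {e : A} {E : fieldType} {m : nat} {phi : {rmorphism A -> 'M[E]_m}}.
Hypothesis e_prim : central_primitive_idempotent e.
Hypothesis phi_split : splitting e phi.

(** For m = 0 every coordinate row represents the zero matrix, so uniqueness forces d = 0, and then
    [e] is an empty sum. *)
Lemma splitting_dim_gt0 : (0 < m)%N.
Proof.
have [[_ ee] e_neq0 _] := e_prim; have [_ _ [d [u [_ Abase Ebase]]]] := phi_split.
rewrite lt0n; apply: contra_neq e_neq0 => m0; subst m.
case: d u Abase Ebase => [|d] u Abase Ebase.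
  by have [z [[_ ->] _]] := Abase e ee; rewrite big_ord0.
have [c [_ cU]] := Ebase 0.
have E1 (B : 'M[E]_0) : 0 = B by rewrite [RHS]flatmx0.
have := cU (const_mx 1) (E1 _); rewrite (cU 0 (E1 _)) => /matrixP /(_ 0 0).
by rewrite !mxE => /esym/eqP; rewrite oner_eq0.
Qed.

(* Separability provides an irreducible p with p(z) e = 0; if phi(z) = 0 then
   p(0) = 0, so p is a multiple of 'X. *)
Lemma splitting_inj_centre z : block_centre e z -> phi z = 0 -> z = 0.
Proof.
move=> z_e phi_z; have [_ ze] := z_e.
have [[_ ee] _ _] := e_prim.
have [p [[p_gt1 p_irr] _ pz]] := A_separable.2 e z e_prim z_e.
have p0 : p`_0 = 0.
  have: phi ((map_poly (in_alg A) p).[z] * e) = 0 by rewrite pz raddf0.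
  rewrite rmorphM; have [-> _ _] := phi_split; rewrite mulr1 horner_coef.
  rewrite size_map_poly -(prednK (ltnW p_gt1)) big_ord_recl expr0 mulr1.
  rewrite raddfD raddf_sum big1 ?addr0 => [|i _]; last first.
    by rewrite /= exprS !rmorphM phi_z mul0r mulr0.
  (* A nonzero constant coefficient would be a unit killed by [phi], giving 1 = 0 in matrices of
     positive size. *)
  rewrite coef_map /= => phi_p0; apply/eqP; apply: contraT => p0.
  have: phi ((p`_0)^-1%:A * (p`_0)%:A) = 0 by rewrite rmorphM phi_p0 mulr0.
  rewrite mulr_algl scalerA mulVf // scale1r rmorph1.
  move=> /matrixP /(_ (Ordinal splitting_dim_gt0) (Ordinal splitting_dim_gt0)).
  by rewrite !mxE eqxx => /eqP; rewrite oner_eq0.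
have Xp : 'X %| p by rewrite -['X]subr0 -polyC0 dvdp_XsubCl /root horner_coef0 p0.
have := p_irr 'X; rewrite size_polyX => /(_ isT Xp) /eqp_size.
rewrite size_polyX => size_p.
have p1 : p`_1 != 0.
  have: lead_coef p != 0 by rewrite lead_coef_eq0 -size_poly_gt0 -size_p.
  by rewrite lead_coefE -size_p.
move: pz; rewrite horner_coef size_map_poly -size_p big_ord_recl big_ord1 /=.
rewrite !coef_map /= p0 scale0r mul0r add0r expr1 -mulrA ze mulr_algl.
by move/eqP; rewrite scaler_eq0 (negPf p1) => /eqP.
Qed.

(** Under [phi] the coordinates of [a] become scalars of E, namely the coordinates of [phi a] in the
    basis [phi (u k)]. These vanish, and [phi] is injective on the block centre. *)
Lemma splitting_inj a : a * e = a -> phi a = 0 -> a = 0.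
Proof.
have [phi_e phi_scal [d [u [ue Abase Ebase]]]] := phi_split.
move=> ae; have [z [[z_e ->] _]] := Abase a ae => phi_a.
have [c [_ cU]] := Ebase 0.
pose i0 := Ordinal splitting_dim_gt0; pose w := \row_k phi (z 0 k) i0 i0.
have phi_z k : phi (z 0 k) = (w 0 k)%:M.
  by have /is_scalar_mxP[x Dx] := phi_scal _ (z_e k); rewrite mxE Dx mxE eqxx.
have w0 : w = 0.
  rewrite -(cU w); last first.
    rewrite -[LHS]phi_a raddf_sum; apply: eq_bigr => k _.
    by rewrite /= rmorphM phi_z -mul_scalar_mx.
  by apply: cU; rewrite big1 // => k _; rewrite mxE scale0r.
rewrite big1 // => k _; rewrite (splitting_inj_centre (z_e k)) ?mul0r //.
by rewrite phi_z w0 mxE raddf0.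
Qed.

Context {f : forall b, 'M[A]_b -> {poly A}}.
Hypothesis f_char : forall b (H : 'M[A]_b) j,
  block_centre e (f H)`_j /\
  phi (f H)`_j = ((char_poly (map_block phi H))`_j)%:M.

(** By injectivity on the block centre, a coefficient of [f H] vanishes exactly when its counterpart
    over E does. *)
Lemma size_redchar b (H : 'M[A]_b) : size (f H) = (\sum_(i < b) m).+1.
Proof.
have f0 j : ((f H)`_j == 0) = ((char_poly (map_block phi H))`_j == 0).
  have [f_e phi_f] := f_char H j; apply/eqP/eqP => [f0|c0].
    move: phi_f; rewrite f0 raddf0.
    move=> /matrixP /(_ (Ordinal splitting_dim_gt0) (Ordinal splitting_dim_gt0)).
    by rewrite !mxE eqxx.
  by apply: splitting_inj_centre => //; rewrite phi_f c0 raddf0.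
have size_le (R S : nzRingType) (p : {poly R}) (q : {poly S}) :
    (forall j, (p`_j == 0) = (q`_j == 0)) -> (size p <= size q)%N.
  move=> pq; apply/leq_sizeP => j qj; apply/eqP.
  by rewrite pq nth_default.
rewrite -(size_char_poly (map_block phi H)).
by apply/eqP; rewrite eqn_leq !size_le.
Qed.

(** Each entry lies in A e, where [phi] is injective, and its image is a block of the identity for
    [map_block phi H]. *)
Lemma reduced_Cayley_Hamilton b (H : 'M[A]_b) :
  \sum_(j < size (f H)) (f H)`_j *: (e *: H ^+ j) = 0.
Proof.
have [[/centreT_in eC ee] _ _] := e_prim.
apply/matrixP => i k; rewrite mxE; apply: splitting_inj.
  rewrite summxE mulr_suml; apply: eq_bigr => j _.
  by rewrite !mxE -mulrA -eC [e * (e * _)]mulrA ee.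
have /mxblockP/(_ i k) := Cayley_Hamilton_sum (map_block phi H).
rewrite submxblock0 submxblock_sum => CH; rewrite -[RHS]CH.
rewrite summxE raddf_sum size_redchar; apply: eq_bigr => j _ /=.
have [phi_e _ _] := phi_split.
rewrite !mxE !rmorphM phi_e mul1r (f_char H j).2 -map_blockX.
rewrite -(mxblockK (fun i k => phi ((H ^+ j) i k)) i k).
by apply: etrans (mul_scalar_mx _ _) _; apply/matrixP => x y; rewrite !mxE.
Qed.

End Splitting.

(** * Reduced norm and adjoint in one block *)

Section BlockNorm.
Context {F : fieldType} {A : falgType F}.
Hypothesis A_separable : separable_algebra A.
Context {e : A}.
Hypothesis e_prim : central_primitive_idempotent e.

(** The second case is the default of [redcharpoly]; norm and adjoint of the block are then 0. *)
Lemma redcharpolyP :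
  is_redcharpoly e (redcharpoly e) \/ forall b (H : 'M[A]_b), redcharpoly e H = 0.
Proof.
rewrite /redcharpoly; case: pselect => [ex|_]; last by right.
by left; apply: svalP.
Qed.

Lemma nr_block_central b (H : 'M[A]_b) : centre predT (nr_block e H).
Proof.
apply/centreT_in => y; rewrite /nr_block.
have f0C : (redcharpoly e H)`_0 * y = y * (redcharpoly e H)`_0.
  have [[E [m [phi [_ f_char]]]] | ->] := redcharpolyP; last first.
    by rewrite coef0 mul0r mulr0.
  by have [[/centreT_in f0C _] _] := f_char _ H 0%N.
by rewrite -mulrA f0C mulrA -(commr_sign y) mulrA.
Qed.

(** Cayley-Hamilton with the constant term moved across; the extra sign in the adjoint compensates
    the change of side. *)
Lemma mul_adjoint_block b (H : 'M[A]_b) :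
  adjoint_block e H *m H = (nr_block e H)%:M.
Proof.
rewrite /adjoint_block /nr_block /reddeg.
have [[E [m [phi [phi_split f_char]]]] | f0] := redcharpolyP; last first.
  by rewrite f0 size_poly0 big_geq // scaler0 mul0mx coef0 mulr0 raddf0.
have := reduced_Cayley_Hamilton A_separable e_prim phi_split f_char H.
have size_f := size_redchar A_separable e_prim phi_split f_char H.
have [[f0_central f0e] _] := f_char _ H 0%N.
rewrite size_f /= big_ord_recl => /eqP; rewrite addrC addr_eq0 => /eqP CH.
rewrite big_add1 /= big_mkord -scalemxAl mulmx_suml.
have step j : (redcharpoly e H)`_j.+1 *: (e *: H ^+ j) *m H =
    (redcharpoly e H)`_j.+1 *: (e *: H ^+ j.+1).
  by rewrite -!scalemxAl exprSr.
rewrite (eq_bigr _ (fun (j : 'I_(\sum_(i < b) m)) _ => step j)).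
rewrite CH exprS mulN1r scaleNr scalerN opprK.
(* The constant term carries the block unit [e], which its coefficient absorbs. *)
by rewrite !scale_scalar_mx mulr1 f0e.
Qed.

(** [phi] sends both sides to 1. The common value is left unnamed: it is [e], or 0 for the default
    polynomial. *)
Lemma nr_block1 b c : nr_block e (1%:M : 'M[A]_b) = nr_block e (1%:M : 'M[A]_c).
Proof.
have [[E [m [phi [phi_split f_char]]]] | f0] := redcharpolyP; last first.
  by rewrite /nr_block !f0 !coef0 !mulr0.
have phi_nr n : phi (nr_block e (1%:M : 'M_n)) = 1.
  rewrite rmorphM rmorphXn rmorphN1 (f_char n _ 0%N).2 -/(map_block phi _).
  rewrite map_block1 char_poly_det det1 mulr1 /reddeg.
  rewrite (size_redchar A_separable e_prim phi_split f_char) /=.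
  by rewrite rmorphXn /= raddfN -expr2 sqrr_sign.
have nr_e n : nr_block e (1%:M : 'M_n) * e = nr_block e (1%:M : 'M_n).
  by rewrite -mulrA (f_char n _ 0%N).1.2.
apply/eqP; rewrite -subr_eq0; apply/eqP.
apply: (splitting_inj A_separable e_prim phi_split).
  by rewrite mulrBl !nr_e.
by rewrite raddfB /= !phi_nr subrr.
Qed.

End BlockNorm.

(** * Reduced norm and adjoint summed over the blocks *)

Section Norm.
Context {F : fieldType} {A : falgType F}.
Hypothesis A_separable : separable_algebra A.
Context {t : nat} {e : 'I_t -> A}.
Hypothesis e_prim : forall i, central_primitive_idempotent (e i).

Lemma nr_central b (H : 'M[A]_b) : centre predT (nr e H).
Proof.
apply/centreT_in => y; rewrite /nr mulr_suml mulr_sumr.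
by apply: eq_bigr => i _; have /centreT_in -> := nr_block_central (e := e i) H.
Qed.

Lemma mul_adjoint b (H : 'M[A]_b) : adjoint e H *m H = (nr e H)%:M.
Proof.
rewrite /adjoint /nr mulmx_suml raddf_sum.
by apply: eq_bigr => i _; rewrite mul_adjoint_block.
Qed.

(* For b = 0 the norm is read off the 1 x 1 identity matrix: a 0 x 0 adjoint
   carries no information. *)
Lemma nr_in (G : subringClosed A) b (H : 'M[A]_b) :
  calH e G 1 -> H \is a mxOver G -> nr e H \in G.
Proof.
move=> [_ adjG].
have nr_pos n (K : 'M[A]_n.+1) : K \is a mxOver G -> nr e K \in G.
  move=> KG; have /mxOverP/(_ 0 0) : adjoint e K *m K \is a mxOver G.
    by rewrite mxOverM // -[adjoint e K]scale1r adjG.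
  by rewrite mul_adjoint mxE eqxx.
case: b H => [|b] H HG; last exact: nr_pos.
rewrite [H]flatmx0 -[0](flatmx0 1%:M) (_ : nr e _ = nr e (1%:M : 'M_1)).
  by apply: nr_pos; rewrite mxOver_scalar ?rpred0 ?rpred1.
by apply: eq_bigr => i _; apply: nr_block1.
Qed.

End Norm.

(** * The central conductor *)

Section Conductor.
Context {A : nzRingType} {Gamma Lambda : subringClosed A}.

Lemma conductorM x y :
  conductor Gamma Lambda x -> centre Gamma y -> conductor Gamma Lambda (x * y).
Proof.
move=> [[xG xC] xL] [yG yC]; split; last first.
  by move=> z zG; rewrite -mulrA xL ?rpredM.
by split=> [|z zG]; rewrite ?rpredM // -mulrA yC // mulrA xC // mulrA.
Qed.

Lemma conductor_sum n (x : 'I_n -> A) :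
  (forall i, conductor Gamma Lambda (x i)) ->
  conductor Gamma Lambda (\sum_i x i).
Proof.
move=> xF; split; first split.
- by rewrite rpred_sum // => i _; have [[]] := xF i.
- move=> y yG; rewrite mulr_suml mulr_sumr; apply: eq_bigr => i _.
  by have [[_ ->]] := xF i.
- move=> y yG; rewrite mulr_suml rpred_sum // => i _.
  by have [_ ->] := xF i.
Qed.

(** Adjoints of matrices over [Lambda] have entries in [Gamma], which a conductor element multiplies
    into [Lambda]. *)
Lemma sub_conductor_calH t (e : 'I_t -> A) :
  {subset Lambda <= Gamma} -> calH e Gamma 1 ->
  conductor Gamma Lambda `<=` calH e Lambda.
Proof.
move=> sLG [_ adjG] x [[_ xC] xG]; split.
  by split=> [|y /sLG]; [rewrite -[x]mulr1 xG ?rpred1 | apply: xC].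
move=> b H HL; have /mxOverP adjH : adjoint e H \is a mxOver Gamma.
  by rewrite -[adjoint e H]scale1r adjG //; apply: mxOverS HL.
by apply/mxOverP => i j; rewrite mxE xG.
Qed.

End Conductor.

(** An order spans the algebra over the field of fractions. This makes the centre of [Lambda]
    commute with [Gamma]. *)
Lemma order_centre (o : idomainType) (A : falgType {fraction o})
    (L : subringClosed A) x :
  is_order L -> centre L x -> centre predT x.
Proof.
move=> [_ span] [_ xC]; apply/centreT_in => y.
have [n [c [g [gL ->]]]] := span y.
rewrite mulr_sumr mulr_suml; apply: eq_bigr => i _.
by rewrite -scalerAr -scalerAl xC.
Qed.

(** * Annihilators of presented modules *)

Section Annihilator.
Context {A : nzRingType} {L : subringClosed A} {M : lmodType (order_ring L)}.

Lemma annihilator0 : annihilator M 0.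
Proof.
exists 0; split=> [||y]; rewrite ?scale0r ?raddf0 //.
by split=> [|y _]; rewrite ?rpred0 ?mul0r ?mulr0.
Qed.

Lemma annihilator_sum n (x : 'I_n -> A) :
  (forall i, annihilator M (x i)) -> annihilator M (\sum_i x i).
Proof.
move=> Mx; elim/big_ind: _ => [||i _]; [exact: annihilator0 | | exact: Mx].
move=> _ _ [z [-> [zL zC] zM]] [w [-> [wL wC] wM]].
exists (z + w); split=> [||v]; last by rewrite scalerDl zM wM addr0.
  by rewrite raddfD.
split=> [|v vL]; first exact: rpredD.
by rewrite mulrDl mulrDr zC ?wC.
Qed.

Lemma mxOver_order_ring a b (K : 'M[A]_(a, b)) :
  K \is a mxOver L -> exists K' : 'M[order_ring L]_(a, b), map_mx val K' = K.
Proof.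
move=> /mxOverP KL; exists (map_mx (insubd (0 : order_ring L)) K).
by apply/matrixP => i j; rewrite !mxE insubdK.
Qed.

(** For a row v, the row z v = v K ([rowsub r h]) is a combination of rows of [h], so [pi] kills
    it. *)
Lemma presentation_annihilator a b (h : 'M[order_ring L]_(a, b))
    (r : 'I_b -> 'I_a) (K : 'M[A]_b) z :
  is_presentation M h -> centre L z -> K \is a mxOver L ->
  K *m map_mx val (rowsub r h) = z%:M -> annihilator M z.
Proof.
move=> [pi [pi_surj pi_ker]] [zL zC] /mxOver_order_ring[K' <-] Kh.
exists (OrderRing zL); split=> // y.
have {}Kh : K' *m rowsub r h = (OrderRing zL)%:M.
  have: map_mx val (K' *m rowsub r h) = map_mx val (OrderRing zL)%:M.
    by rewrite map_mxM Kh map_scalar_mx.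
  move/matrixP=> eqK; apply/matrixP => i j; apply: val_inj.
  by have := eqK i j; rewrite !mxE.
have [v <-] := pi_surj y; rewrite -linearZ; apply/pi_ker.
(* [rowsub r 1%:M] is the selection matrix: its product with [h] extracts the rows chosen by [r]. *)
exists (v *m K' *m rowsub r 1%:M).
rewrite -mulmxA -rowsubE -mulmxA Kh; apply/rowP => j.
rewrite !mxE (bigD1 j) //= big1 => [|i /negPf ij]; last by rewrite mxE ij mulr0.
rewrite mxE eqxx addr0; apply: val_inj; rewrite !rmorphM.
(* The scalar matrix puts z to the right of the entries of v, the module action to the left. *)
by apply: zC; apply: valP.
Qed.

(** The alternative 0 covers both the default of [fitmax] and presentations with a < b. *)
Lemma fitmax_fit t (e : 'I_t -> A) x :
  fitmax e M x -> x = 0 \/ exists a b (h : 'M[order_ring L]_(a, b)),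
    is_presentation M h /\
    span_over (calU e L)
      [set x | exists r : 'I_b -> 'I_a,
         {homo r : i j / (i < j)%N} /\ x = nr e (map_mx val (rowsub r h))] x.
Proof.
rewrite /fitmax; case: pselect => [ex|_]; last by left.
case: (svalP (cid ex)) => [[a [b [h [h_pres ->]]]] _]; rewrite /fit.
by case: ifP => _; [right; exists a, b, h | left].
Qed.

End Annihilator.

Theorem proposition6p2
  (o : idomainType) (o_fitting : fitting_domain o)
  (A : falgType {fraction o}) (A_separable : separable_algebra A)
  (t : nat) (e : 'I_t -> A)
  (e_enum : enumerates_central_primitive_idempotents e)
  (Lambda Gamma Lambda' : subringClosed A)
  (Lambda_order : is_order Lambda)
  (Gamma_order : is_order Gamma)
  (Lambda'_max : is_maximal_order Lambda')
  (Lambda_sub : {subset Lambda <= Gamma})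
  (Gamma_sub : {subset Gamma <= Lambda'})
  (M : lmodType (order_ring Lambda)) (M_fg : fin_gen_module M)
  (calH_Gamma : calH e Gamma = centre Gamma) :
  conductor Gamma Lambda `<=` calH e Lambda /\
  span_over (conductor Gamma Lambda) (fitmax e M) `<=` annihilator M.
Proof.
have e_prim i : central_primitive_idempotent (e i) by apply/e_enum.2; exists i.
have calH1 : calH e Gamma 1.
  by rewrite calH_Gamma; split=> [|y _]; rewrite ?rpred1 ?mul1r ?mulr1.
have F_calH := sub_conductor_calH Lambda_sub calH1.
split=> // _ [n [c [g [cF gM ->]]]]; apply: annihilator_sum => i.
have [->|[a [b [h [h_pres [k [u [H [uU HS ->]]]]]]]]] := fitmax_fit (gM i).
  by rewrite mulr0; apply: annihilator0.
have nr_centre m (K : 'M[A]_m) : K \is a mxOver Lambda -> centre Gamma (nr e K).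
  move=> KL; split; first by rewrite nr_in //; apply: mxOverS KL.
  by move=> y _; apply/centreT_in: y; apply: nr_central.
rewrite mulr_sumr; apply: annihilator_sum => j; rewrite mulrA.
(* Elements of [calU] are only known to lie in [Gamma], so the conductor absorbs them first: each
   summand is a central element of [Lambda] times a norm, both central in [Gamma]. *)
have cuF : conductor Gamma Lambda (c i * u j).
  have [p [d [v [dL vU ->]]]] := uU j; rewrite mulr_sumr.
  apply: conductor_sum => l; have [q [K [[KL _] ->]]] := vU l.
  rewrite mulrA; apply: conductorM; last exact: nr_centre.
  apply: conductorM => //; split; first by apply: Lambda_sub; have [] := dL l.
  by move=> y _; have /centreT_in := order_centre Lambda_order (dL l); apply.
have [r [_ ->]] := HS j; set Hr := map_mx val _.
have HrL : Hr \is a mxOver Lambda by apply/mxOverP => x y; rewrite mxE; apply: valP.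
have [[cu_nrL cu_nrC] _] := F_calH _ (conductorM cuF (nr_centre _ _ HrL)).
(* Since [c i * u j] lies in [calH e Lambda], this multiple of the adjoint is a matrix over
   [Lambda]. *)
pose K := (c i * u j) *: adjoint e Hr.
apply: (presentation_annihilator (r := r) (K := K)) h_pres _ _ _ => //.
  by have [_] := F_calH _ cuF; apply.
by rewrite /K -scalemxAl mul_adjoint // scale_scalar_mx.
Qed.
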